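(* Suppose $0<\Delta t\le 1$. Then for every integer $N\ge1$, the zeroth Fourier-mode vectors $\bm{\sigma}^0,\bm{f}^0$ of the forward Euler scheme for the Dirichlet problem on the unit circle (defined in the context) satisfy $$\|\bm{\sigma}^0\|\;\le\;7\,\|\bm{f}^0\| .$$
   Context: The zeroth Fourier mode of the forward Euler scheme for the double-layer Volterra integral equation of the heat equation Dirichlet problem on the unit circle is the linear system $(-\tfrac12 I-V^0)\bm{\sigma}^0=\bm{f}^0$ for $\bm{\sigma}^0=\{\sigma_j^0\}_{j=0}^N$ with data $\bm{f}^0=\{f_j^0\}_{j=0}^N$ (with the initialization convention $f^0_0=\sigma^0_0=0$), where $I$ is the identity and $V^0\in\mathbb{R}^{(N+1)\times(N+1)}$ has entries $V^0_{jk}=v^0_{j-k}$ for $j>k$ and $0$ otherwise, with $$v^0_l=\int_0^{\Delta t}\gamma_0(l\Delta t-\tau)\,d\tau\ (l\ge1),\qquad \gamma_0(t)=\frac{1}{8\pi t^2}\int_0^{2\pi}(1-\cos s)\,e^{-\frac{1-\cos s}{2t}}\,ds\quad(t>0).$$ $\|\cdot\|$ is the $\ell^2$-norm. *)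

(* Defs.v *)
From HB Require Import structures.
From mathcomp Require Import all_boot all_order all_algebra.
From mathcomp Require Import all_classical all_reals all_analysis.

Set Implicit Arguments.
Unset Strict Implicit.
Unset Printing Implicit Defensive.

Import Order.TTheory GRing.Theory Num.Theory.
Import numFieldNormedType.Exports.

Local Open Scope classical_set_scope.
Local Open Scope ring_scope.

Definition l2norm (R : realType) (n : nat) (x : 'cV[R]_n) : R :=
  Num.sqrt (\sum_(i < n) (x i 0) ^+ 2).

(* Meaningful for t > 0 only. *)
Definition gamma0 (R : realType) (t : R) : R :=
  (8 * pi * t ^+ 2)^-1 *
  \int[lebesgue_measure]_(s in `[0, 2 * pi])
    ((1 - cos s) * expR (- ((1 - cos s) / (2 * t)))).

(* For l = 1 the integrand has an integrable singularity, of order t^(-1/2),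
   at tau = dt; this is why a Lebesgue integral is used.  The junk value
   gamma0 0 at that single point does not affect the integral. *)
Definition v0 (R : realType) (dt : R) (l : nat) : R :=
  \int[lebesgue_measure]_(tau in `[0, dt]) gamma0 (l%:R * dt - tau).

Definition V0 (R : realType) (dt : R) (N : nat) : 'M[R]_N.+1 :=
  \matrix_(j < N.+1, k < N.+1) (if (k < j)%N then v0 dt (j - k)%N else 0).

(* Main.v *)
(* In the energy identity - <sigma, f> = |sigma|^2 / 2 + sum_{k<j} v_{j-k}
   sigma_j sigma_k the total mass of the kernel is exactly the borderline value
   1/2, so cancellation is needed.  The kernel gamma0 is not convex, but it
   dominates the convex function 1 / (4 (1 + t)^2), of mass 1/4.  The cell
   integrals of this minorant form a convex decreasing sequence, whose symmetric
   Toeplitz form is nonnegative once the diagonal is filled in convexly; this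
   costs at most 5/48 |sigma|^2 when dt <= 1.  What is left of gamma0 is
   nonnegative and has mass at most 1/2 - 1/4, hence costs at most
   1/4 |sigma|^2.  The energy is therefore at least 7/48 |sigma|^2, which is
   at least |sigma|^2 / 7. *)
Require Import Defs.
From HB Require Import structures.
From mathcomp Require Import all_boot all_order all_algebra.
From mathcomp Require Import all_classical all_reals all_analysis.
From mathcomp Require Import measurable_realfun ring lra zify.

Set Implicit Arguments.
Unset Strict Implicit.
Unset Printing Implicit Defensive.

Import Order.TTheory GRing.Theory Num.Theory.
Import numFieldNormedType.Exports.

Local Open Scope classical_set_scope.
Local Open Scope ring_scope.

(** * The heat kernel and its integral in time *)

Lemma is_derive_continuous (R : realType) (F : R -> R) (x d : R) :
  is_derive x 1 F d -> {for x, continuous F}.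
Proof.
by move=> [dF _]; apply: differentiable_continuous; exact/derivable1_diffP.
Qed.

Lemma integral_is_derive (R : realType) (f F : R -> R) (a b : R) : a < b ->
  (forall x, a <= x <= b -> is_derive x 1 F (f x)) ->
  (forall x, a <= x <= b -> {for x, continuous f}) ->
  (\int[lebesgue_measure]_(x in `[a, b]) (f x)%:E = (F b - F a)%:E)%E.
Proof.
move=> ab dF cf; rewrite EFinB; apply: continuous_FTC2 => //.
- apply: continuous_in_subspaceT => x; rewrite inE/= in_itv/= => /cf; exact.
- have cF x : a <= x <= b -> {for x, continuous F}.
    by move=> /dF; exact: is_derive_continuous.
  split; first by move=> x; rewrite in_itv/= => /andP[ax xb]; case: (dF x); rewrite ?ltW.
  + by apply: cvg_at_right_filter; apply: cF; rewrite lexx ltW.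
  + by apply: cvg_at_left_filter; apply: cF; rewrite lexx ltW.
- move=> x; rewrite in_itv/= => /andP[ax xb].
  by rewrite derive1E; case: (dF x); rewrite ?ltW.
Qed.

(** Time derivative of [exp(-a/(2t))]. With [a = 1 - cos s], integrating over the circle and
    dividing by [4 pi] gives [gamma0]. *)
Definition heat_kernel (R : realType) (a t : R) : R :=
  a / (2 * t ^+ 2) * expR (- (a / (2 * t))).

(* At [t = 0] the formula would give [expR 0 = 1] because [1 / 0 = 0], instead
   of the limit [0]; [heat_kernel] in contrast has the right value there. *)
Definition heat_primitive (R : realType) (a t : R) : R :=
  if t <= 0 then 0 else expR (- (a / (2 * t))).

Section heat.
Variable R : realType.
Implicit Types a t c h : R.

Lemma heat_kernel_ge0 a t : 0 <= a -> 0 <= heat_kernel a t.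
Proof.
by move=> a0; rewrite mulr_ge0 ?expR_ge0// divr_ge0// mulr_ge0// sqr_ge0.
Qed.

Lemma heat_kernel_continuous a t : 0 < t -> {for t, continuous (heat_kernel a)}.
Proof.
move=> t0; rewrite /heat_kernel; apply: cvgM.
  apply: cvgM; first exact: cvg_cst.
  apply: cvgV; first by rewrite mulf_neq0 ?expf_neq0 ?gt_eqF.
  apply: cvgM; first exact: cvg_cst.
  exact: exprn_continuous.
apply: continuous_comp; last exact: continuous_expR.
apply: cvgN; apply: cvgM; first exact: cvg_cst.
apply: cvgV; first by rewrite mulf_neq0 ?gt_eqF.
apply: cvgM; [exact: cvg_cst|exact: cvg_id].
Qed.

Lemma heat_primitive_is_derive a t : 0 < t ->
  is_derive t 1 (heat_primitive a) (heat_kernel a t).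
Proof.
move=> t0.
pose f u := expR (- (a / (2 * u))).
have ft : \near t, f t = heat_primitive a t.
  near=> u; rewrite /heat_primitive leNgt.
  suff -> : 0 < u by [].
  by near: u; exact: lt_nbhsr.
apply: near_eq_is_derive ft _.
have t20 : 2 * t != 0 by rewrite mulf_neq0 ?gt_eqF.
apply: is_derive_eq.
rewrite /heat_kernel /= /GRing.scale /=; field; exact: lt0r_neq0.
Unshelve. all: by end_near. Qed.


(** The cubic Taylor term gives [exp v >= v^3 / 6] for [v = a/(2t)]. This linear decay makes the
    kernel continuous at time 0, as is needed when a cell reaches that endpoint. *)
Lemma heat_kernel_le a t : 0 < a -> 0 <= t -> heat_kernel a t <= 24 / a ^+ 2 * t.
Proof.
move=> a0; rewrite le_eqVlt => /predU1P[<-|t0].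
  by rewrite /heat_kernel expr0n/= !mulr0 invr0 mulr0 mul0r.
have v0 : 0 < a / (2 * t) by rewrite divr_gt0// mulr_gt0.
have := expR_ge1Dxn 2 (ltW v0); rewrite /heat_kernel expRN.
set v := a / (2 * t) in v0 *; rewrite -[_`!%N]/6%N => ev.
have e6 : (expR v)^-1 <= 6 / v ^+ 3.
  rewrite -[leRHS]invrK lef_pV2 ?posrE ?expR_gt0 ?invr_gt0 ?divr_gt0 ?exprn_gt0//.
  by rewrite invf_div; apply: le_trans ev; rewrite lerDr.
apply: (le_trans (ler_wpM2l _ e6)).
  by rewrite divr_ge0 ?mulr_ge0 ?sqr_ge0// ltW.
rewrite /v le_eqVlt; apply/orP; left; apply/eqP; field.
by rewrite !lt0r_neq0.
Qed.

Lemma heat_primitive_ge0 a t : 0 <= heat_primitive a t.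
Proof. by rewrite /heat_primitive; case: ifP => // _; exact: expR_ge0. Qed.

Lemma heat_primitive_le a t : 0 < a -> 0 <= t -> heat_primitive a t <= 2 / a * t.
Proof.
move=> a0; rewrite le_eqVlt => /predU1P[<-|t0].
  by rewrite /heat_primitive lexx mulr0.
rewrite /heat_primitive (leNgt t) t0/=.
have v0 : 0 < a / (2 * t) by rewrite divr_gt0// mulr_gt0.
have -> : 2 / a * t = (a / (2 * t))^-1 by field; rewrite !lt0r_neq0.
rewrite expRN lef_pV2 ?posrE ?expR_gt0//.
by apply: le_trans (expR_ge1Dx _); rewrite lerDr.
Qed.

Let cvg_at_left_sub0 (f : R -> R) (C h : R) : 0 < h -> f 0 = 0 ->
  (forall t, 0 <= t -> 0 <= f t <= C * t) -> (fun x => f (h - x)) @ h^'- --> f (h - h).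
Proof.
move=> h0 f0 fC; rewrite subrr f0.
apply: (@squeeze_cvgr _ _ _ _ (cst 0) (fun x => C * (h - x))).
- near=> x; apply: fC; rewrite subr_ge0; near: x; exact: nbhs_left_le.
- exact: cvg_cst.
- apply: cvg_at_left_filter; rewrite -[X in _ --> X](mulr0 C) -(subrr h).
  apply: cvgM; first exact: cvg_cst.
  by apply: cvgB; [exact: cvg_cst|exact: cvg_id].
Unshelve. all: by end_near. Qed.

Lemma integral_heat_kernel a c h : 0 < a -> 0 < h <= c ->
  (\int[lebesgue_measure]_(x in `[0%R, h]) (heat_kernel a (c - x))%:E =
   (heat_primitive a c - heat_primitive a (c - h))%:E)%E.
Proof.
move=> a0 /andP[h0 hc].
have dF x : x < c ->
    is_derive x 1 (fun x => - heat_primitive a (c - x)) (heat_kernel a (c - x)).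
  rewrite -subr_gt0 => xc; have ? := heat_primitive_is_derive a xc.
  have ? : is_derive x 1 (fun y => c - y) (- 1) by apply: is_derive_eq; rewrite add0r mul1r.
  have ? : is_derive x 1 (fun y => heat_primitive a (c - y)) (- heat_kernel a (c - x)).
    by apply: is_derive_eq; rewrite /GRing.scale /=; ring.
  by apply: is_derive_eq; rewrite opprK.
have cf x : x < c -> {for x, continuous (fun x => heat_kernel a (c - x))}.
  rewrite -subr_gt0 => xc; apply: continuous_comp.
    by apply: cvgB; [exact: cvg_cst|exact: cvg_id].
  exact: heat_kernel_continuous.
have -> : heat_primitive a c - heat_primitive a (c - h) =
    - heat_primitive a (c - h) - (- heat_primitive a (c - 0)).
  by rewrite opprK subr0 addrC.
(* If [h < c], the time [c - x] stays positive. If [h = c] it reaches 0 at [x = h], where only left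
   limits are available; they come from the linear bounds above. *)
move: hc; rewrite le_eqVlt => /predU1P[hc|hc]; last first.
  apply: (@integral_is_derive _ (fun x => heat_kernel a (c - x))
    (fun x => - heat_primitive a (c - x))) => // x /andP[x0 xh]; [apply: dF|apply: cf];
  exact: le_lt_trans hc.
rewrite -hc in dF cf *; rewrite EFinB.
apply: (@continuous_FTC2 _ (fun x => heat_kernel a (h - x))
  (fun x => - heat_primitive a (h - x))) => //.
- apply/continuous_within_itvP => //; split.
  + by move=> x; rewrite in_itv/= => /andP[_ ?]; exact: cf.
  + by apply: cvg_at_right_filter; exact: cf.
  + apply: (@cvg_at_left_sub0 (heat_kernel a) (24 / a ^+ 2)) => //.
      by rewrite /heat_kernel expr0n/= !mulr0 invr0 mulr0 mul0r.
    by move=> t t0; rewrite heat_kernel_le// heat_kernel_ge0// ltW.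
- split.
  + by move=> x; rewrite in_itv/= => /andP[_ ?]; case: (dF x).
  + apply: cvg_at_right_filter; 
    exact: is_derive_continuous (dF 0 h0).
  + apply: cvgN; apply: (@cvg_at_left_sub0 (heat_primitive a) (2 / a)) => //.
      by rewrite /heat_primitive lexx.
    by move=> t t0; rewrite heat_primitive_le// heat_primitive_ge0.
- by move=> x; rewrite in_itv/= => /andP[_ ?]; rewrite derive1E; case: (dF x).
Qed.

(** At [a = 0] the kernel vanishes but the primitive jumps from 0 to 1 at time 0, so equality is
    lost when [c = h]. The angles with [cos s = 1] produce this case. *)
Lemma integral_heat_kernel_le a c h : 0 <= a -> 0 < h <= c ->
  (\int[lebesgue_measure]_(x in `[0%R, h]) (heat_kernel a (c - x))%:E <=
   (heat_primitive a c - heat_primitive a (c - h))%:E)%E.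
Proof.
rewrite le_eqVlt => /predU1P[<-|a0] hc; last by rewrite integral_heat_kernel.
rewrite (eq_integral (cst 0%E)); last by move=> x _; rewrite /heat_kernel !mul0r.
rewrite integral0 lee_fin subr_ge0 /heat_primitive !mul0r oppr0 expR0.
case/andP: hc => h0 hc; rewrite (leNgt c) (lt_le_trans h0 hc)/=.
by case: ifP.
Qed.

End heat.

(** * Tonelli's theorem on measurable rectangles *)

Section fubini.
Variables (d1 d2 : measure_display) (T1 : measurableType d1) (T2 : measurableType d2).
Variables (R : realType) (m1 : {sigma_finite_measure set T1 -> \bar R}).
Variable m2 : {sigma_finite_measure set T2 -> \bar R}.
Variables (A : set T1) (B : set T2) (f : T1 * T2 -> \bar R).
Hypotheses (mA : measurable A) (mB : measurable B).
Hypotheses (mf : measurable_fun [set: T1 * T2] f) (f0 : forall x, (0 <= f x)%E).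

(** Extending [f] by zero outside the rectangle reduces both claims to the whole product space. *)
Let g := f \_ (A `*` B).

Let mg : measurable_fun [set: T1 * T2] g.
Proof.
apply/(measurable_restrictT _ _).1; first exact: measurableX.
exact: measurable_funTS.
Qed.

Let g0 z : (0 <= g z)%E.
Proof. by rewrite /g /patch; case: ifP. Qed.

Let gE1 x : (\int[m2]_y g (x, y) = ((fun x => \int[m2]_(y in B) f (x, y)) \_ A) x)%E.
Proof.
rewrite [RHS]/patch; case: ifPn => [xA|xA].
  rewrite [RHS]integral_mkcond; apply: eq_integral => y _.
  by rewrite /g /patch in_setX/= xA.
rewrite (eq_integral (cst 0%E)) ?integral0// => y _.
by rewrite /g /patch in_setX/= (negbTE xA).
Qed.

Let gE2 y : (\int[m1]_x g (x, y) = ((fun y => \int[m1]_(x in A) f (x, y)) \_ B) y)%E.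
Proof.
rewrite [RHS]/patch; case: ifPn => [yB|yB].
  rewrite [RHS]integral_mkcond; apply: eq_integral => x _.
  by rewrite /g /patch in_setX/= yB andbT.
rewrite (eq_integral (cst 0%E)) ?integral0// => x _.
by rewrite /g /patch in_setX/= (negbTE yB) andbF.
Qed.

Lemma fubini_tonelli_on :
  (\int[m1]_(x in A) \int[m2]_(y in B) f (x, y) =
   \int[m2]_(y in B) \int[m1]_(x in A) f (x, y))%E.
Proof.
rewrite [LHS]integral_mkcond [RHS]integral_mkcond.
under eq_integral do rewrite -gE1.
under [RHS]eq_integral do rewrite -gE2.
exact: fubini_tonelli.
Qed.

Lemma measurable_fun_fubini_tonelli_on :
  measurable_fun A (fun x => (\int[m2]_(y in B) f (x, y))%E).
Proof.
apply/measurable_restrictT => //.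
rewrite [X in measurable_fun _ X](_ : _ = fubini_F m2 g).
  exact: measurable_fun_fubini_tonelli_F.
by apply/funext => x; rewrite /fubini_F gE1.
Qed.

End fubini.

(** Inversion is continuous off 0, and the remaining point is a measurable singleton. This serves
    the joint measurability of the heat kernel in time and angle. *)
Lemma measurable_invr (R : realType) : measurable_fun [set: R] (@GRing.inv R).
Proof.
rewrite -(setUv [set 0 : R]); apply/measurable_funU => //.
  exact: measurableC.
split; first exact: measurable_fun_set1.
apply: open_continuous_measurable_fun.
  rewrite (_ : ~` _ = [set x : R | x != 0]); first exact: open_neq.
  by apply/seteqP; split=> x /= /eqP.
by move=> x; rewrite inE/= => /eqP x0; exact: inv_continuous.
Qed.

(** * Time integrals of [gamma0] over cells *)

Section gamma.
Variable R : realType.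
Implicit Types s t c h : R.

Let versine s : R := 1 - cos s.

Let versine_ge0 s : 0 <= versine s.
Proof. by rewrite subr_ge0 cos_le1. Qed.

Let versine_continuous : continuous versine.
Proof. by move=> s; apply: cvgB; [exact: cvg_cst|exact: continuous_cos]. Qed.

Let four_piV_ge0 : 0 <= (4 * pi)^-1 :> R.
Proof. by rewrite invr_ge0 mulr_ge0// pi_ge0. Qed.

Lemma integrable_segment_continuous (f : R -> R) (a b : R) : continuous f ->
  (@lebesgue_measure R).-integrable `[a, b] (EFin \o f).
Proof.
move=> cf; apply: continuous_compact_integrable; first exact: segment_compact.
exact: continuous_subspaceT.
Qed.

Let heat_primitive_versine_continuous t :
  continuous (fun s => heat_primitive (versine s) t).
Proof.
rewrite /heat_primitive; case: (t <= 0) => s; first exact: cvg_cst.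
apply: continuous_comp; last exact: continuous_expR.
by apply: cvgN; apply: cvgM; [exact: versine_continuous|exact: cvg_cst].
Qed.

Lemma gamma0_ge0 t : 0 <= gamma0 t.
Proof.
rewrite mulr_ge0//.
  by rewrite invr_ge0 mulr_ge0 ?sqr_ge0// mulr_ge0// pi_ge0.
by apply: Rintegral_ge0 => s _; rewrite mulr_ge0 ?expR_ge0 ?versine_ge0.
Qed.

Lemma gamma0E t : ((gamma0 t)%:E =
  \int[lebesgue_measure]_(s in `[0%R, (2 * pi)%R])
    ((4 * pi)^-1 * heat_kernel (1 - cos s) t)%:E)%E.
Proof.
rewrite /gamma0 -RintegralZl//; last first.
  apply: integrable_segment_continuous => s; apply: cvgM; first exact: versine_continuous.
  apply: continuous_comp; last exact: continuous_expR.
  by apply: cvgN; apply: cvgM; [exact: versine_continuous|exact: cvg_cst].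
rewrite fineK; last first.
  apply: integrable_fin_num => //; apply: integrable_segment_continuous => s.
  apply: cvgM; [exact: cvg_cst|apply: cvgM; first exact: versine_continuous].
  apply: continuous_comp; last exact: continuous_expR.
  by apply: cvgN; apply: cvgM; [exact: versine_continuous|exact: cvg_cst].
apply: eq_integral => s _; congr EFin.
(* At [t = 0] both sides are 0 because [1 / 0 = 0]. *)
rewrite /heat_kernel; have [->|t0] := eqVneq t 0.
  by rewrite expr0n/= !(mulr0, invr0, mul0r).
by have := lt0r_neq0 (@pi_gt0 R); move: pi => p p0; field; rewrite p0 t0.
Qed.

(** Average of the time primitives, vanishing for [t <= 0]: its increments bound the cell integrals
    of [gamma0], and hence the entries [v0]. *)
Definition heat_mass t : R :=
  \int[lebesgue_measure]_(s in `[0, 2 * pi])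
    ((4 * pi)^-1 * heat_primitive (1 - cos s) t).

Lemma heat_mass_integrable t : (@lebesgue_measure R).-integrable `[0, 2 * pi]
  (EFin \o (fun s => (4 * pi)^-1 * heat_primitive (1 - cos s) t)).
Proof.
apply: integrable_segment_continuous => s; apply: cvgM; first exact: cvg_cst.
exact: heat_primitive_versine_continuous.
Qed.

Let heat_kernel_measurable c : measurable_fun [set: R * R]
  (fun z : R * R => heat_kernel (1 - cos z.2) (c - z.1)).
Proof.
have mc : measurable_fun [set: R * R] (fun z : R * R => 1 - cos z.2).
  exact: (measurableT_comp (continuous_measurable_fun versine_continuous)
    measurable_snd).
have mt : measurable_fun [set: R * R] (fun z : R * R => c - z.1).
  by apply: measurable_funB => //; exact: measurable_fst.
apply: measurable_funM.
  apply: measurable_funM => //; apply: (measurableT_comp (@measurable_invr R)).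
  by apply: measurable_funM => //; exact: measurable_funX.
apply: (measurableT_comp (@measurable_expR R)); apply: measurable_funN.
apply: measurable_funM => //; apply: (measurableT_comp (@measurable_invr R)).
exact: measurable_funM.
Qed.

Let kernel_measurable c : measurable_fun [set: R * R] (fun z : R * R =>
  ((4 * pi)^-1 * heat_kernel (1 - cos z.2) (c - z.1))%:E).
Proof. by apply/measurable_EFinP; exact: measurable_funM. Qed.

Let kernel_ge0 c z : (0 <= ((4 * pi)^-1 * heat_kernel (1 - cos z.2) (c - z.1))%:E)%E.
Proof. by rewrite lee_fin mulr_ge0// heat_kernel_ge0. Qed.

Lemma gamma0_cell_measurable c h :
  measurable_fun `[0, h] (fun x => (gamma0 (c - x))%:E).
Proof.
rewrite (funext (fun x => gamma0E (c - x))).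
apply: (@measurable_fun_fubini_tonelli_on _ _ _ _ _ (@lebesgue_measure R) _ _ _ _ _
  (kernel_measurable c)) => //.
Qed.

(** Tonelli moves the time integral inside, where it is bounded angle by angle. Taking [c = h]
    covers the singular first cell and yields its integrability. *)
Lemma integral_gamma0_le c h : 0 < h <= c ->
  (\int[lebesgue_measure]_(x in `[0%R, h]) (gamma0 (c - x))%:E <=
   (heat_mass c - heat_mass (c - h))%:E)%E.
Proof.
move=> hc; under eq_integral do rewrite gamma0E.
rewrite (@fubini_tonelli_on _ _ _ _ _ (@lebesgue_measure R) (@lebesgue_measure R)
  _ _ _ _ _ (kernel_measurable c)) //=.
have mass_integrable : (@lebesgue_measure R).-integrable `[0%R, (2 * pi)%R]
    ((EFin \o (fun s => (4 * pi)^-1 * heat_primitive (1 - cos s) c)%R) \-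
     (EFin \o (fun s => (4 * pi)^-1 * heat_primitive (1 - cos s) (c - h))%R))%E.
  by apply: integrableB => //; exact: heat_mass_integrable.
rewrite /heat_mass -RintegralB//; [|exact: heat_mass_integrable..].
rewrite fineK; last exact: integrable_fin_num.
apply: ge0_le_integral => //.
- by move=> s _; apply: integral_ge0 => x _; rewrite lee_fin mulr_ge0// heat_kernel_ge0.
(* The outer variable is now the angle, so the coordinates of the kernel are swapped. *)
- apply: (@measurable_fun_fubini_tonelli_on _ _ _ _ _ (@lebesgue_measure R) _ _
    (fun z => ((4 * pi)^-1 * heat_kernel (1 - cos z.1) (c - z.2))%:E)) => //.
  + have := @measurable_swap _ _ (measurableTypeR R) (measurableTypeR R).
    move=> /(measurableT_comp (kernel_measurable c)).
    exact.
  + by move=> z; exact: kernel_ge0 (z.2, z.1).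
- exact: measurable_int mass_integrable.
move=> s _; under eq_integral do rewrite EFinM.
rewrite ge0_integralZl_EFin//; last 2 first.
- by move=> x _; rewrite lee_fin heat_kernel_ge0.
- apply/measurable_EFinP; apply: measurable_funTS.
  exact: (measurableT_comp (heat_kernel_measurable c) (pair2_measurable s)).
rewrite -mulrBr EFinM lee_pmul2l// ?lte_fin ?invr_gt0 ?mulr_gt0 ?pi_gt0//.
by apply: integral_heat_kernel_le.
Qed.

End gamma.

(** * Bounds on the kernel *)

Lemma Rintegral_is_derive (R : realType) (f F : R -> R) (a b : R) : a < b ->
  (forall x, a <= x <= b -> is_derive x 1 F (f x)) ->
  (forall x, a <= x <= b -> {for x, continuous f}) ->
  \int[lebesgue_measure]_(x in `[a, b]) f x = F b - F a.
Proof. by move=> ab dF cf; rewrite /Rintegral (integral_is_derive ab dF cf). Qed.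

Section bounds.
Variable R : realType.
Implicit Types s t c h x y : R.

Let pi2_gt0 : 0 < 2 * pi :> R.
Proof. by rewrite mulr_gt0// pi_gt0. Qed.

Let sin2pi : sin (2 * pi) = 0 :> R.
Proof. by rewrite mulr_natl sin2pi. Qed.

Let cos2pi : cos (2 * pi) = 1 :> R.
Proof. by rewrite mulr_natl cos2pi. Qed.

Lemma heat_mass0 t : t <= 0 -> heat_mass t = 0.
Proof.
move=> t0; rewrite /heat_mass /heat_primitive t0 /Rintegral.
by under eq_integral do rewrite mulr0; rewrite integral0.
Qed.

(** With [u = cos s], [exp(-v) <= 1/(1+v)] bounds the primitive by [2t/(2t+1-u)]. This is convex in
    [u], hence below its chord on [[-1, 1]], which is affine in [cos s] and integrates explicitly.
    The loss [1/(4(1+t))] is exactly the tail mass beyond [t] of the convex minorant. *)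
Lemma heat_mass_le t : 0 < t -> heat_mass t <= 2^-1 - (4 * (1 + t))^-1.
Proof.
move=> t0; have t1 : 0 < 1 + t by rewrite addr_gt0.
pose f s := (4 * pi)^-1 * (1 - (1 - cos s) / (2 * (1 + t))).
have cf : continuous f.
  move=> s; apply: cvgM; first exact: cvg_cst.
  apply: cvgB; first exact: cvg_cst.
  apply: cvgM; last exact: cvg_cst.
  by apply: cvgB; [exact: cvg_cst|exact: continuous_cos].
pose F s := (4 * pi)^-1 * (s - (s - sin s) / (2 * (1 + t))).
have dF s : is_derive s 1 F (f s).
  by apply: is_derive_eq; rewrite /f /GRing.scale /=; ring.
have -> : 2^-1 - (4 * (1 + t))^-1 = F (2 * pi) - F 0.
  rewrite /F sin2pi sin0; have := lt0r_neq0 (@pi_gt0 R); move: pi => p p0.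
  by field; rewrite p0 lt0r_neq0.
rewrite -(@Rintegral_is_derive _ f)//; last by move=> ? _; exact: cf.
apply: le_Rintegral => //.
- exact: heat_mass_integrable.
- exact: integrable_segment_continuous.
move=> s _; rewrite ler_wpM2l ?invr_ge0 ?mulr_ge0 ?pi_ge0//.
rewrite /heat_primitive (leNgt t) t0/=.
have := cos_le1 s; have := cos_geN1 s; move: (cos s) => u u0 u1.
have v0 : 0 <= (1 - u) / (2 * t) by rewrite divr_ge0 ?mulr_ge0 ?subr_ge0// ltW.
rewrite expRN; apply: (@le_trans _ _ (1 + (1 - u) / (2 * t))^-1).
  by rewrite lef_pV2 ?posrE ?expR_gt0 ?ltr_wpDr// expR_ge1Dx.
have d0 : 0 < 2 * t + (1 - u) by lra.
rewrite -subr_ge0 (_ : _ - _ = (1 - u) * (1 + u) / (2 * (1 + t) * (2 * t + (1 - u)))).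
  by rewrite divr_ge0 ?mulr_ge0//; lra.
by field; rewrite !lt0r_neq0.
Qed.

(** By convexity the left side lies below its chord between [y = 0] and [y = 4], and [exp(3/2) <= 5]
    puts that chord below [1 + y]. *)
Lemma expR_le_affine y : 0 <= y <= 4 -> expR (3 * y / 8) <= 1 + y.
Proof.
move=> /andP[y0 y4].
have e32 : expR (3 / 2) <= 5 :> R.
  rewrite -[leRHS]invrK -[leLHS]invrK -expRN lef_pV2 ?posrE ?expR_gt0//.
  (* Twelve factors suffice: [exp(-1/8) >= 7/8] and [(7/8)^12 >= 1/5]. *)
  have -> : - (3 / 2) = 12%:R * (- (1 / 8)) :> R by field.
  rewrite expRM_natl; apply: (@le_trans _ _ ((7 / 8) ^+ 12)).
    lra.
  by rewrite lerXn2r ?nnegrE ?expR_ge0//; apply: le_trans (expR_ge1Dx _); lra.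
have i01 : 0 <= y / 4 <= 1 by apply/andP; split; lra.
have := convex_expR (Itv01 (andP i01).1 (andP i01).2) (3 / 2) 0.
rewrite !convRE/= expR0 /unstable.onem mulr0 addr0 => e_le.
have -> : 3 * y / 8 = y / 4 * (3 / 2) by field.
apply: (le_trans e_le); rewrite mulr1.
have := ler_wpM2l (andP i01).1 e32; lra.
Qed.

(** At [y = 4] this is [exp 2 >= (3/2)^4 >= 5]. Beyond, [exp(y/2 - 2) >= y/2 - 1], and
    [5 (y/2 - 1) >= 1 + y] as soon as [y >= 4]. *)
Lemma expR_ge_affine y : 4 <= y -> 1 + y <= expR (y / 2).
Proof.
move=> y4; have e2 : 5 <= expR 2 :> R.
  have -> : 2 = 4%:R * (1 / 2) :> R by field.
  rewrite expRM_natl; apply: (@le_trans _ _ ((3 / 2) ^+ 4)); first lra.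
  by rewrite lerXn2r ?nnegrE ?expR_ge0//; apply: le_trans (expR_ge1Dx _); lra.
have -> : y / 2 = 2 + (y / 2 - 2) by ring.
rewrite expRD; apply: (@le_trans _ _ (5 * (1 + (y / 2 - 2)))); first lra.
by apply: ler_pM => //; [lra|exact: expR_ge1Dx].
Qed.


Let gamma0_integrand_continuous t :
  continuous (fun s => (1 - cos s) * expR (- ((1 - cos s) / (2 * t)))).
Proof.
have cv : continuous (fun s : R => 1 - cos s).
  by move=> s; apply: cvgB; [exact: cvg_cst|exact: continuous_cos].
move=> s; apply: cvgM; first exact: cv.
apply: continuous_comp; last exact: continuous_expR.
by apply: cvgN; apply: cvgM; [exact: cv|exact: cvg_cst].
Qed.

(* Jensen: [expR (- u) >= expR (- v) * (1 + v - u)] with [v] the mean of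
   [u = (1 - cos s) / (2 * t)] for the weight [1 - cos s]. *)
Let gamma0_ge_expR t : 0 < t -> expR (- (3 / (4 * t))) / (4 * t ^+ 2) <= gamma0 t.
Proof.
move=> t0; set v := 3 / (4 * t).
pose f s := expR (- v) * ((1 - cos s) * (1 + v - (1 - cos s) / (2 * t))).
have cf : continuous f.
  have cv : continuous (fun s : R => 1 - cos s).
    by move=> s; apply: cvgB; [exact: cvg_cst|exact: continuous_cos].
  move=> s; apply: cvgM; first exact: cvg_cst.
  apply: cvgM; first exact: cv.
  apply: cvgB; first exact: cvg_cst.
  by apply: cvgM; [exact: cv|exact: cvg_cst].
pose F s := expR (- v) * ((1 + v) * (s - sin s)
  - (3 / 2 * s - 2 * sin s + sin s * cos s / 2) / (2 * t)).
have dF s : is_derive s 1 F (f s).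
  apply: is_derive_eq; rewrite /f /GRing.scale /=.
  have s2 : sin s ^+ 2 = 1 - cos s ^+ 2 by rewrite -(cos2Dsin2 s); ring.
  have -> : sin s * - sin s = - sin s ^+ 2 by ring.
  rewrite s2; move: (sin s) (cos s) (expR _) => *; field; exact: lt0r_neq0.
(* Since [v] is the weighted mean, the first-order term integrates to 0, leaving the total weight
   [2 pi]. *)
have FE : F (2 * pi) - F 0 = expR (- v) * (2 * pi).
  rewrite /F sin2pi cos2pi sin0 /v; move: pi => p; move: (expR _) => e.
  by field; rewrite lt0r_neq0.
rewrite /gamma0; have -> : expR (- v) / (4 * t ^+ 2) =
    (8 * pi * t ^+ 2)^-1 * (F (2 * pi) - F 0).
  rewrite FE; have := lt0r_neq0 (@pi_gt0 R); move: pi => p p0; move: (expR _) => e.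
  by field; rewrite p0 lt0r_neq0.
have k0 : 0 <= (8 * pi * t ^+ 2)^-1.
  by rewrite invr_ge0 mulr_ge0 ?sqr_ge0// mulr_ge0// pi_ge0.
rewrite ler_wpM2l//.
rewrite -(@Rintegral_is_derive _ f F)//; last by move=> ? _; exact: cf.
apply: le_Rintegral => //; try exact: integrable_segment_continuous.
move=> s _; rewrite /f mulrCA ler_wpM2l ?subr_ge0 ?cos_le1//.
move: (_ / _) => u.
have -> : expR (- u) = expR (- v) * expR (v - u) by rewrite -expRD; congr expR; ring.
rewrite ler_wpM2l ?expR_ge0//.
by apply: le_trans (expR_ge1Dx _); lra.
Qed.

(* [|sin s| <= 1] makes the integrand explicitly integrable. *)
Let gamma0_ge_sin t : 0 < t ->
  (1 - (1 + t^-1) * expR (- t^-1)) / pi <= gamma0 t.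
Proof.
move=> t0.
pose f s := (1 - cos s) * expR (- ((1 - cos s) / (2 * t))).
have cf : continuous f by exact: gamma0_integrand_continuous.
have f0 s : 0 <= f s by rewrite mulr_ge0 ?expR_ge0// subr_ge0 cos_le1.
pose g s := f s * sin s.
have cg : continuous g.
  by move=> s; apply: cvgM; [exact: cf|exact: continuous_sin].
pose G s := - (2 * t * (1 - cos s) + 4 * t ^+ 2) * expR (- ((1 - cos s) / (2 * t))).
have dG s : is_derive s 1 G (g s).
  apply: is_derive_eq; rewrite /g /f /GRing.scale /=.
  by move: (sin s) (cos s) (expR _) => *; field; exact: lt0r_neq0.
(* Used with [k = 1] on [[0, pi]] and [k = -1] on [[pi, 2 pi]], so that [k sin s] is [|sin s|]. *)
have half (a b k : R) : a < b -> (forall s, k * sin s <= 1) ->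
    k * (G b - G a) <= \int[lebesgue_measure]_(s in `[a, b]) f s.
  move=> ab ks.
  pose g' s := k * g s.
  have cg' : continuous g' by move=> s; apply: cvgM; [exact: cvg_cst|exact: cg].
  have dG' s : is_derive s 1 (fun s => k * G s) (g' s).
    by apply: is_derive_eq; rewrite /GRing.scale/= /g'; ring.
  rewrite mulrBr -(@Rintegral_is_derive _ g' (fun s => k * G s))//; last first.
    by move=> ? _; exact: cg'.
  apply: le_Rintegral => //; try exact: integrable_segment_continuous.
  by move=> s _; rewrite /g' /g mulrCA -[leRHS]mulr1 ler_wpM2l.
have pi0 := @pi_gt0 R.
have := half 0 pi 1 pi0; have := half pi (2 * pi) (- 1).
rewrite mulN1r mul1r => h2 h1.
have {}h2 : - (G (2 * pi) - G pi) <= \int[lebesgue_measure]_(s in `[pi, 2 * pi]) f s.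
  by apply: h2 => [|s]; [lra|have := sin_geN1 s; lra].
have {}h1 : G pi - G 0 <= \int[lebesgue_measure]_(s in `[0, pi]) f s.
  by apply: h1 => s; rewrite mul1r sin_le1.
have fE : \int[lebesgue_measure]_(s in `[0, 2 * pi]) f s =
    \int[lebesgue_measure]_(s in `[0, pi]) f s +
    \int[lebesgue_measure]_(s in `[pi, 2 * pi]) f s.
  rewrite -[X in _ = _ + X]Rintegral_itv_obnd_cbnd; last first.
    apply: integrableS (integrable_segment_continuous pi (2 * pi) cf) => //.
    exact: subset_itv_oc_cc.
  rewrite -(@Rintegral_itvB _ _ (BLeft 0) (BRight (2 * pi)) pi) ?bnd_simp ?ltW//.
  - by rewrite addrC subrK.
  - exact: integrable_segment_continuous.
  - lra.
have GE : G pi - G 0 - (G (2 * pi) - G pi) =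
    8 * t ^+ 2 * (1 - (1 + t^-1) * expR (- t^-1)).
  rewrite /G cospi cos2pi cos0 subrr mul0r oppr0 expR0.
  rewrite (_ : (1 - -1) / (2 * t) = t^-1); last by field; exact: lt0r_neq0.
  by move: (expR _) => e; field; exact: lt0r_neq0.
have -> : (1 - (1 + t^-1) * expR (- t^-1)) / pi = (8 * pi * t ^+ 2)^-1 *
    (G pi - G 0 - (G (2 * pi) - G pi)).
  rewrite GE; move: (expR _) => e; move: pi pi0 => p p0.
  by field; rewrite !lt0r_neq0.
rewrite /gamma0 ler_wpM2l//.
  by rewrite invr_ge0 mulr_ge0 ?sqr_ge0// mulr_ge0// pi_ge0.
by rewrite [leRHS]fE lerD.
Qed.

(** Put [y = 1/t]. For [y <= 4] the Jensen bound suffices, because [exp(3y/4) <= (1+y)^2]. For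
    [y > 4], [exp(-y) <= (1+y)^(-2)] turns the sine bound into [1/(pi (1+t))], and [pi <= 4]
    finishes. *)
Lemma gamma0_ge t : 0 < t -> (4 * (1 + t) ^+ 2)^-1 <= gamma0 t.
Proof.
move=> t0; have t1 : 0 < 1 + t by rewrite addr_gt0.
have y0 : 0 < t^-1 by rewrite invr_gt0.
have y1 : 0 <= 1 + t^-1 by rewrite addr_ge0// ltW.
have [y4|y4] := leP t^-1 4.
- apply: le_trans (gamma0_ge_expR t0); rewrite expRN.
  have -> : 3 / (4 * t) = 2%:R * (3 * t^-1 / 8) by field; exact: lt0r_neq0.
  rewrite expRM_natl.
  have -> : (4 * (1 + t) ^+ 2)^-1 = ((1 + t^-1) ^+ 2)^-1 / (4 * t ^+ 2).
    by field; rewrite !lt0r_neq0// addrC.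
  apply: ler_wpM2r; first by rewrite invr_ge0 mulr_ge0 ?sqr_ge0.
  rewrite lef_pV2 ?posrE ?exprn_gt0 ?expR_gt0 ?addr_gt0//.
  rewrite lerXn2r ?nnegrE ?expR_ge0//.
  by apply: expR_le_affine; rewrite (ltW y0).
- apply: le_trans (gamma0_ge_sin t0).
  have e1 : expR (- t^-1) <= ((1 + t^-1) ^+ 2)^-1.
    rewrite expRN lef_pV2 ?posrE ?exprn_gt0 ?expR_gt0 ?addr_gt0//.
    have -> : expR t^-1 = expR (t^-1 / 2) ^+ 2.
      by rewrite -expRM_natl; congr expR; field; exact: lt0r_neq0.
    by rewrite lerXn2r ?nnegrE ?expR_ge0// expR_ge_affine// ltW.
  have e2 : (1 + t)^-1 <= 1 - (1 + t^-1) * expR (- t^-1).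
    rewrite (_ : (1 + t)^-1 = 1 - (1 + t^-1) * ((1 + t^-1) ^+ 2)^-1).
      by rewrite lerB// ler_wpM2l.
    by field; rewrite !lt0r_neq0// addrC.
  apply: (@le_trans _ _ ((1 + t)^-1 / 4)).
    rewrite -invfM lef_pV2 ?posrE ?mulr_gt0 ?exprn_gt0//; nra.
  apply: ler_pM => //; first by rewrite invr_ge0 ltW.
  by rewrite lef_pV2 ?posrE ?pi_gt0//; have := @pihalf_lt2 R; lra.
Qed.

Let gamma0_cell_integrable c h : 0 < h <= c ->
  (@lebesgue_measure R).-integrable `[0, h] (EFin \o (fun x => gamma0 (c - x))).
Proof.
move=> hc; apply/integrableP; split; first exact: gamma0_cell_measurable.
apply: le_lt_trans (ltry (heat_mass c - heat_mass (c - h))).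
under eq_integral => x _ do rewrite /= ger0_norm ?gamma0_ge0//.
exact: integral_gamma0_le.
Qed.

Lemma v0_le h l : 0 < h ->
  v0 h l.+1 <= heat_mass (l.+1%:R * h) - heat_mass (l%:R * h).
Proof.
move=> h0; have hc : 0 < h <= l.+1%:R * h.
  by rewrite h0/= -[leLHS]mul1r ler_wpM2r ?ler1n ?(ltW h0).
rewrite -lee_fin /v0 /Rintegral fineK; last first.
  exact: integrable_fin_num (gamma0_cell_integrable hc).
have -> : l%:R * h = l.+1%:R * h - h by rewrite -natr1; ring.
exact: integral_gamma0_le.
Qed.

(** Integral of [1/(4(1+t)^2)] over [[l h, (l+1) h]]. The index is shifted by one: this cell is the
    one of [v0 h l.+1]. *)
Definition cell_minorant h (l : nat) : R :=
  ((1 + l%:R * h)^-1 - (1 + l.+1%:R * h)^-1) / 4.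

Lemma v0_ge h l : 0 < h -> cell_minorant h l <= v0 h l.+1.
Proof.
move=> h0; have hc : 0 < h <= l.+1%:R * h.
  by rewrite h0/= -[leLHS]mul1r ler_wpM2r ?ler1n ?(ltW h0).
set c := l.+1%:R * h in hc *.
have c1 x : x <= h -> 0 < 1 + (c - x) by case/andP: hc => *; lra.
pose f x := (4 * (1 + (c - x)) ^+ 2)^-1.
pose F x := (1 + (c - x))^-1 / 4.
have dF x : 0 <= x <= h -> is_derive x 1 F (f x).
  move=> /andP[_ /c1 /lt0r_neq0 xh].
  apply: is_derive_eq; rewrite /f /GRing.scale /=; field; exact: xh.
have cf x : 0 <= x <= h -> {for x, continuous f}.
  move=> /andP[_ /c1 xh]; apply: cvgV.
    by rewrite mulf_neq0 ?expf_neq0 ?lt0r_neq0.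
  apply: cvgM; first exact: cvg_cst.
  apply: (@continuous_comp _ _ _ (fun x => 1 + (c - x)) (fun y => y ^+ 2)).
    by apply: cvgD; [exact: cvg_cst|apply: cvgB; [exact: cvg_cst|exact: cvg_id]].
  exact: exprn_continuous.
have fi : (@lebesgue_measure R).-integrable `[0, h] (EFin \o f).
  apply: continuous_compact_integrable; first exact: segment_compact.
  by apply: continuous_in_subspaceT => x; rewrite inE/= in_itv/= => /cf.
have -> : cell_minorant h l = F h - F 0.
  rewrite /cell_minorant /F /c -natr1 subr0.
  rewrite (_ : (l%:R + 1) * h - h = l%:R * h); last by ring.
  exact: mulrBl.
rewrite -(Rintegral_is_derive h0 dF cf) /v0 -/c.
(* [gamma0 0] is a junk value, so the endpoint [x = h] is removed. *)
rewrite -!Rintegral_itv_bndo_bndc//; last 2 first.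
- apply: integrableS (gamma0_cell_integrable hc) => //; exact: subset_itv_co_cc.
- by apply: integrableS fi => //; exact: subset_itv_co_cc.
apply: le_Rintegral => //.
- by apply: integrableS fi => //; exact: subset_itv_co_cc.
- apply: integrableS (gamma0_cell_integrable hc) => //; exact: subset_itv_co_cc.
move=> x; rewrite /= in_itv/= => /andP[_ xh]; apply: gamma0_ge.
by case/andP: hc => *; lra.
Qed.

(** Both bounds telescope. At the final time the tail term in [heat_mass_le] cancels that of the
    minorant, leaving [1/2 - 1/4] for every [N]. *)
Lemma sum_v0_sub_cell_minorant h N : 0 < h -> (0 < N)%N ->
  \sum_(l < N) (v0 h l.+1 - cell_minorant h l) <= 4^-1.
Proof.
move=> h0 N0; have Nh : 0 < N%:R * h by rewrite mulr_gt0// ltr0n.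
apply: (@le_trans _ _ (\sum_(l < N) ((heat_mass (l.+1%:R * h) + (1 + l.+1%:R * h)^-1 / 4)
    - (heat_mass (l%:R * h) + (1 + l%:R * h)^-1 / 4)))).
  by apply: ler_sum => l _; have := v0_le l h0; rewrite /cell_minorant; lra.
rewrite -(big_mkord xpredT (fun l => (heat_mass (l.+1%:R * h) + (1 + l.+1%:R * h)^-1 / 4)
    - (heat_mass (l%:R * h) + (1 + l%:R * h)^-1 / 4))).
rewrite (@telescope_sumr _ 0 N (fun l => heat_mass (l%:R * h) + (1 + l%:R * h)^-1 / 4))//.
rewrite mul0r (heat_mass0 (lexx 0)) add0r addr0 invr1.
by have := heat_mass_le Nh; rewrite invfM; lra.
Qed.

End bounds.

(** * Toeplitz forms of convex sequences *)

Section toeplitz.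
Variable R : realFieldType.
Implicit Types (w r : nat -> R) (n : nat).

(** This is [|i - j|]: one of the two truncated differences is always 0. *)
Let dist (i j : nat) : nat := ((i - j) + (j - i))%N.

Lemma sum_window (a b M : nat) :
  (\sum_(m < M) ((a <= m) && (m < b)))%N = (minn b M - a)%N.
Proof. by elim: M => [|M IHM]; rewrite ?big_ord0 ?big_ord_recr/= ?IHM; lia. Qed.

(* The triangle [k - |i - j|] counts the windows of length [k] containing both
   [i] and [j], so its quadratic form is a sum of squared window sums. *)
Lemma triangle_form_ge0 n (k : nat) (x : 'I_n -> R) :
  0 <= \sum_(i < n) \sum_(j < n) (k - dist i j)%N%:R * (x i * x j).
Proof.
pose b (m i : nat) : bool := ((i <= m) && (m < i + k))%N.
suff -> : \sum_(i < n) \sum_(j < n) (k - dist i j)%N%:R * (x i * x j) =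
    \sum_(m < n + k) (\sum_(i < n) (b m i)%:R * x i) ^+ 2.
  by apply: sumr_ge0 => m _; exact: sqr_ge0.
under [RHS]eq_bigr do rewrite expr2 big_distrlr/=.
rewrite [RHS]exchange_big; apply: eq_bigr => i _.
rewrite [RHS]exchange_big; apply: eq_bigr => j _.
under eq_bigr do rewrite mulrACA.
rewrite -mulr_suml; congr (_ * _).
under eq_bigr do rewrite -natrM mulnb.
rewrite -natr_sum; congr _%:R.
(* The windows are indexed by their last element [m]; those containing both points have
   [max(i,j) <= m < min(i,j) + k]. *)
transitivity (minn (minn (i + k) (j + k)) (n + k) - maxn i j)%N.
  by rewrite /dist; have := ltn_ord i; have := ltn_ord j; lia.
by rewrite -sum_window; apply: eq_bigr => m _; congr nat_of_bool; rewrite /b; lia.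
Qed.

(** Two summations by parts, that is, a discrete Taylor expansion at [K] with the second differences
    in the remainder. Truncated subtraction turns the coefficients into triangles in [l]. *)
Lemma convex_triangle_sum w (K l : nat) : (l <= K)%N ->
  w l = w K + (K - l)%N%:R * (w K - w K.+1) +
    \sum_(k < K) (k.+1 - l)%N%:R * (w k - 2 * w k.+1 + w k.+2).
Proof.
elim: K => [|K IHK]; first by case: l => // _; rewrite big_ord0 mul0r !addr0.
rewrite leq_eqVlt => /predU1P[->|lK].
  rewrite subnn mul0r addr0 big1 ?addr0// => k _.
  by rewrite (_ : (k.+1 - K.+1)%N = 0%N) ?mul0r//; have := ltn_ord k; lia.
rewrite big_ord_recr/= [LHS]IHK//.
by rewrite (_ : (K.+1 - l)%N = (K - l).+1)%N -?natr1; [ring|lia].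
Qed.

(** Expanding [w] at [n], which exceeds all distances, splits the form into the square of the total
    sum and triangle forms, all with nonnegative coefficients. *)
Lemma convex_toeplitz_form_ge0 n w (x : 'I_n -> R) :
  (forall k, 0 <= w k) -> (forall k, w k.+1 <= w k) ->
  (forall k, 0 <= w k - 2 * w k.+1 + w k.+2) ->
  0 <= \sum_(i < n) \sum_(j < n) w (dist i j) * (x i * x j).
Proof.
move=> w_ge0 w_noninc w_convex.
have -> : \sum_(i < n) \sum_(j < n) w (dist i j) * (x i * x j) =
    w n * (\sum_(i < n) x i) ^+ 2 +
    (w n - w n.+1) * (\sum_(i < n) \sum_(j < n) (n - dist i j)%N%:R * (x i * x j)) +
    \sum_(k < n) (w k - 2 * w k.+1 + w k.+2) *
      (\sum_(i < n) \sum_(j < n) (k.+1 - dist i j)%N%:R * (x i * x j)).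
  under [X in _ + X]eq_bigr => k _.
    rewrite big_distrr/=; under eq_bigr do rewrite big_distrr/=; over.
  rewrite [X in _ + X]exchange_big expr2 big_distrlr/= !big_distrr/= -!big_split/=.
  apply: eq_bigr => i _.
  rewrite [X in _ + X]exchange_big !big_distrr/= -!big_split/=.
  apply: eq_bigr => j _.
  rewrite (@convex_triangle_sum w n); last first.
    by rewrite /dist; have := ltn_ord i; have := ltn_ord j; lia.
  rewrite !mulrDl big_distrl/=; congr (_ + _ + _); first by ring.
  by apply: eq_bigr => k _; ring.
apply: addr_ge0; first apply: addr_ge0.
- by rewrite mulr_ge0 ?sqr_ge0.
- by rewrite mulr_ge0 ?subr_ge0 ?triangle_form_ge0.
by apply: sumr_ge0 => k _; rewrite mulr_ge0 ?triangle_form_ge0.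
Qed.

Lemma sum_symmetric n (S : 'I_n -> 'I_n -> R) : (forall i j, S i j = S j i) ->
  \sum_(i < n) \sum_(j < n) S i j =
  \sum_(i < n) S i i + 2 * (\sum_(i < n) \sum_(j < n | (j < i)%N) S i j).
Proof.
move=> SC; have -> : \sum_(i < n) \sum_(j < n) S i j =
    \sum_(i < n) (S i i + \sum_(j < n | (j < i)%N) S i j +
      \sum_(j < n | (i < j)%N) S i j).
  apply: eq_bigr => i _; rewrite (bigD1 i)//= -addrA; congr (_ + _).
  rewrite (bigID (fun j : 'I_n => (j < i)%N))/=; congr (_ + _); apply: eq_bigl => j;
  by rewrite -val_eqE/=; lia.
rewrite !big_split/= mulr_natl mulr2n addrA; congr (_ + _).
rewrite (exchange_big_dep xpredT)//=; apply: eq_bigr => i _.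
by apply: eq_bigr => j _; exact: SC.
Qed.

(** The full symmetric form is nonnegative and equals its diagonal part plus twice the lower
    part. *)
Lemma convex_lower_form_ge n w (x : 'I_n -> R) :
  (forall k, 0 <= w k) -> (forall k, w k.+1 <= w k) ->
  (forall k, 0 <= w k - 2 * w k.+1 + w k.+2) ->
  - (w 0%N / 2 * \sum_(i < n) x i ^+ 2) <=
  \sum_(i < n) \sum_(j < n | (j < i)%N) w (i - j)%N * (x i * x j).
Proof.
move=> w0 w1 w2; have := convex_toeplitz_form_ge0 x w0 w1 w2.
rewrite sum_symmetric => [|i j]; last by rewrite /dist addnC (mulrC (x i)).
under eq_bigr => i _ do rewrite /dist !subnn -expr2.
rewrite -mulr_sumr.
under [X in _ + 2 * X]eq_bigr => i _.
  under eq_bigr => j ji.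
    rewrite /dist (_ : (i - j + (j - i))%N = (i - j)%N); last by lia.
    over.
  over.
lra.
Qed.

Lemma lower_row_sum_le n r (i : 'I_n.+1) : (forall l, 0 <= r l) ->
  \sum_(j < n.+1 | (j < i)%N) r (i - j)%N <= \sum_(l < n) r l.+1.
Proof.
move=> r0; have iN : (i <= n)%N by rewrite -ltnS.
rewrite -(big_ord_widen _ (fun j => r (i - j)%N) (ltnW (ltn_ord i))).
rewrite (reindex_inj rev_ord_inj)/=.
under eq_bigr => j _ do rewrite subKn//.
rewrite (big_ord_widen _ (fun j => r j.+1) iN) big_mkcond/=.
by apply: ler_sum => j _; case: ifP.
Qed.

(** Reversing the index order turns columns into rows. *)
Lemma lower_col_sum_le n r (j : 'I_n.+1) : (forall l, 0 <= r l) ->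
  \sum_(i < n.+1 | (j < i)%N) r (i - j)%N <= \sum_(l < n) r l.+1.
Proof.
move=> r0; apply: le_trans (lower_row_sum_le (rev_ord j) r0).
rewrite (reindex_inj rev_ord_inj)/= le_eqVlt; apply/orP; left; apply/eqP.
by apply: eq_big => [i|i _]; [|congr r]; have := ltn_ord i; have := ltn_ord j; lia.
Qed.

(** Schur test: [x_i x_j >= -(x_i^2 + x_j^2)/2], and every row sum and column sum is at most the
    total mass of [r]. *)
Lemma lower_form_ge n r (x : 'I_n.+1 -> R) : (forall l, 0 <= r l) ->
  - ((\sum_(l < n) r l.+1) * \sum_(i < n.+1) x i ^+ 2) <=
  \sum_(i < n.+1) \sum_(j < n.+1 | (j < i)%N) r (i - j)%N * (x i * x j).
Proof.
move=> r0; set rho := \sum_(l < n) _.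
have row : \sum_(i < n.+1) \sum_(j < n.+1 | (j < i)%N) r (i - j)%N * x i ^+ 2 <=
    rho * \sum_(i < n.+1) x i ^+ 2.
  rewrite mulr_sumr; apply: ler_sum => i _.
  by rewrite -mulr_suml ler_wpM2r ?sqr_ge0// lower_row_sum_le.
have col : \sum_(i < n.+1) \sum_(j < n.+1 | (j < i)%N) r (i - j)%N * x j ^+ 2 <=
    rho * \sum_(i < n.+1) x i ^+ 2.
  rewrite (exchange_big_dep xpredT)//= mulr_sumr; apply: ler_sum => j _.
  by rewrite -mulr_suml ler_wpM2r ?sqr_ge0// lower_col_sum_le.
apply: (@le_trans _ _ (- 2^-1 *
  (\sum_(i < n.+1) \sum_(j < n.+1 | (j < i)%N) r (i - j)%N * x i ^+ 2 +
   \sum_(i < n.+1) \sum_(j < n.+1 | (j < i)%N) r (i - j)%N * x j ^+ 2))); first lra.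
rewrite -big_split/= mulr_sumr; apply: ler_sum => i _.
rewrite -big_split/= mulr_sumr; apply: ler_sum => j _.
rewrite -mulrDr mulrCA ler_wpM2l//.
have := sqr_ge0 (x i + x j); nra.
Qed.

End toeplitz.

(** * The energy estimate *)

Section kernel_minorant.
Variables (R : realType) (h : R).
Hypotheses (h_gt0 : 0 < h) (h_le1 : h <= 1).

Let cell_denom_gt0 (l : nat) : 0 < 1 + l%:R * h.
Proof. by rewrite ltr_wpDr// mulr_ge0// ltW. Qed.

Lemma cell_minorant_ge0 l : 0 <= cell_minorant h l.
Proof.
rewrite divr_ge0// subr_ge0 lef_pV2 ?posrE//.
by rewrite lerD2l ler_wpM2r ?ler_nat// ltW.
Qed.

Lemma cell_minorant_noninc l : cell_minorant h l.+1 <= cell_minorant h l.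
Proof.
rewrite -subr_ge0 /cell_minorant; have := cell_denom_gt0 l.
rewrite -!natr1 !mulrDl mul1r !addrA; move: (1 + _) => A A0.
have A1 : 0 < A + h by exact: addr_gt0.
have A2 : 0 < A + h + h by exact: addr_gt0.
rewrite (_ : _ - _ = h ^+ 2 / (2 * A * (A + h) * (A + h + h))).
  by rewrite divr_ge0 ?sqr_ge0// !mulr_ge0// ltW.
by field; rewrite !lt0r_neq0.
Qed.

(** Up to the factor 1/4 this is minus the third difference of [1/A] with step [h] at [A = 1 + l h],
    which has a positive closed form. *)
Lemma cell_minorant_convex l :
  0 <= cell_minorant h l - 2 * cell_minorant h l.+1 + cell_minorant h l.+2.
Proof.
rewrite /cell_minorant; have := cell_denom_gt0 l.
rewrite -!natr1 !mulrDl mul1r !addrA; move: (1 + _) => A A0.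
have A1 : 0 < A + h by exact: addr_gt0.
have A2 : 0 < A + h + h by exact: addr_gt0.
have A3 : 0 < A + h + h + h by exact: addr_gt0.
rewrite (_ : _ + _ = 3 * h ^+ 3 / (2 * A * (A + h) * (A + h + h) * (A + h + h + h))).
  by rewrite divr_ge0 ?mulr_ge0 ?exprn_ge0// ltW.
by field; rewrite !lt0r_neq0.
Qed.

(* The value at [0] is the least one that keeps the sequence convex. *)
Definition convex_minorant (l : nat) : R :=
  if l is k.+1 then cell_minorant h k
  else 2 * cell_minorant h 0 - cell_minorant h 1.

(** The constant is the value at [h = 1]; the difference carries the factor [1 - h], so this is
    where [h <= 1] enters. *)
Lemma convex_minorant0_le : convex_minorant 0 / 2 <= 5 / 48.
Proof.
rewrite /= /cell_minorant mul0r !mul1r addr0.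
have h1 : 0 < 1 + h by rewrite addr_gt0.
have h2 : 0 < 1 + 2 * h by rewrite addr_gt0// mulr_gt0.
rewrite -subr_ge0 (_ : _ - _ = (1 - h) * (14 * h + 5) / (48 * (1 + h) * (1 + 2 * h))).
  have := h_gt0; have := h_le1 => le1 gt0.
  by rewrite divr_ge0 ?mulr_ge0//; lra.
by field; rewrite !lt0r_neq0.
Qed.

(** The constant is [17/48 = 5/48 + 1/4]: the diagonal cost of the convex part plus the mass of the
    nonnegative remainder. *)
Lemma v0_lower_form_ge N (x : 'I_N.+1 -> R) : (0 < N)%N ->
  - (17 / 48 * \sum_(i < N.+1) x i ^+ 2) <=
  \sum_(i < N.+1) \sum_(j < N.+1 | (j < i)%N) v0 h (i - j)%N * (x i * x j).
Proof.
move=> N0; pose r (l : nat) : R := v0 h l.+1 - cell_minorant h l.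
(* Shifted to the indexing of [v0]; the value at 0 is never read in the strictly lower form. *)
pose r' l := if l is k.+1 then r k else 0.
have vE (i j : nat) : (j < i)%N -> v0 h (i - j)%N =
    convex_minorant (i - j) + r' (i - j)%N.
  by rewrite -subn_gt0; case: (i - j)%N => // k _; rewrite /= /r addrC subrK.
have -> : \sum_(i < N.+1) \sum_(j < N.+1 | (j < i)%N) v0 h (i - j)%N * (x i * x j) =
    \sum_(i < N.+1) \sum_(j < N.+1 | (j < i)%N) convex_minorant (i - j)%N * (x i * x j) +
    \sum_(i < N.+1) \sum_(j < N.+1 | (j < i)%N) r' (i - j)%N * (x i * x j).
  rewrite -big_split; apply: eq_bigr => i _; rewrite -big_split; apply: eq_bigr => j ji.
  by rewrite vE// mulrDl.
have S0 : 0 <= \sum_(i < N.+1) x i ^+ 2 by apply: sumr_ge0 => i _; exact: sqr_ge0.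
have gS : - (convex_minorant 0 / 2 * \sum_(i < N.+1) x i ^+ 2) <=
    \sum_(i < N.+1) \sum_(j < N.+1 | (j < i)%N) convex_minorant (i - j)%N * (x i * x j).
  apply: convex_lower_form_ge => -[|k]; rewrite /=.
  - by have := cell_minorant_noninc 0; have := cell_minorant_ge0 0; lra.
  - exact: cell_minorant_ge0.
  - by have := cell_minorant_noninc 0; lra.
  - exact: cell_minorant_noninc.
  - lra.
  - exact: cell_minorant_convex.
have rS : - ((\sum_(l < N) r' l.+1) * \sum_(i < N.+1) x i ^+ 2) <=
    \sum_(i < N.+1) \sum_(j < N.+1 | (j < i)%N) r' (i - j)%N * (x i * x j).
  by apply: lower_form_ge => -[|k]//=; rewrite subr_ge0 v0_ge.
have := ler_wpM2r S0 (sum_v0_sub_cell_minorant h_gt0 N0).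
have := ler_wpM2r S0 convex_minorant0_le.
lra.
Qed.

End kernel_minorant.

Theorem corollary2 (R : realType) (dt : R) (N : nat) (sigma f : 'cV[R]_N.+1)
    (hdt : 0 < dt <= 1) (hN : (1 <= N)%N)
    (hf0 : f ord0 0 = 0) (hsigma0 : sigma ord0 0 = 0)
    (hsys : (- 2^-1 *: 1%:M - V0 dt N) *m sigma = f) :
  l2norm sigma <= 7 * l2norm f.
Proof.
have /andP[dt0 dt1] := hdt.
pose x i := sigma i 0.
have fE i : f i 0 = - (x i / 2) -
    \sum_(j < N.+1 | (j < i)%N) v0 dt (i - j)%N * x j.
  rewrite -hsys mulmxBl -scalemxAl mul1mx !mxE mulNr [2^-1 * _]mulrC; congr (_ - _).
  rewrite [RHS]big_mkcond; apply: eq_bigr => j _; rewrite mxE.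
  by case: ifP => // _; rewrite mul0r.
have := v0_lower_form_ge dt0 dt1 x hN.
set S := \sum_(i < N.+1) x i ^+ 2; set L := \sum_(i < N.+1) \sum_(j < _ | _) _.
move=> L_ge.
(* Pairing the system with [sigma]; by the bound on [L] the right side is at least [7/48 S]. *)
have energy : - \sum_(i < N.+1) x i * f i 0 = S / 2 + L.
  rewrite -sumrN mulr_suml -big_split; apply: eq_bigr => i _ /=.
  rewrite fE mulrBr opprB mulr_sumr [RHS]addrC; congr (_ + _).
    by apply: eq_bigr => j _; ring.
  by field.
(* AM-GM: [- x f <= x^2 / 14 + 7 f^2 / 2] *)
have young : - \sum_(i < N.+1) x i * f i 0 <=
    S / 14 + 7 / 2 * \sum_(i < N.+1) f i 0 ^+ 2.
  rewrite -sumrN mulr_suml mulr_sumr -big_split; apply: ler_sum => i _ /=.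
  have := sqr_ge0 (x i + 7 * f i 0); nra.
have S0 : 0 <= S by apply: sumr_ge0 => i _; exact: sqr_ge0.
rewrite /l2norm -[7 in leRHS](@ger0_norm R)// -sqrtr_sqr -sqrtrM ?sqr_ge0//.
(* As [7/48 - 1/14 = 25/336], [S] is at most [1176/25 = 47.04] times the sum of the [f_i^2], below
   the required factor 49. *)
by apply: ler_wsqrtr; rewrite -/S; lra.
Qed.
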